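(* Suppose that $(X,\mathcal{E})$ is a coarse space that can be written as a union of coarse subspaces $X=\bigcup_{\alpha}X_\alpha$, where the family $\{X_\alpha\}_\alpha$ has uniform coarse property C. Suppose moreover that for each entourage $K\in\mathcal{E}$ there is a subset $Y_K\subseteq X$ with coarse property C (in the coarse structure inherited from $X$) such that $\{X_\alpha\setminus Y_K\}_\alpha$ forms a $K$-disjoint collection. Then $X$ has coarse property C.
   Context: A coarse structure on a set $X$ is a collection $\mathcal{E}$ of subsets of $X\times X$, called entourages, such that: subsets of entourages are entourages; finite unions of entourages are entourages; the diagonal $\Delta_X$ is an entourage; inverses $E^{-1}=\{(y,x)\mid (x,y)\in E\}$ of entourages are entourages; compositions $E_1\circ E_2=\{(x,z)\mid \exists y\in X,\ (x,y)\in E_1,\ (y,z)\in E_2\}$ of entourages are entourages. The pair $(X,\mathcal{E})$ is a coarse space. A subset $A\subseteq X$ is regarded as a coarse subspace with the coarse structure obtained by restricting $\mathcal{E}$ to $A\times A$. For $E\in\mathcal{E}$, a family $\mathcal{U}$ of subsets of $X$ is $E$-disjoint if $(A\times B)\cap E=\emptyset$ whenever $A,B\in\mathcal{U}$, $A\ne B$. Put $\Delta_{\mathcal{U}}:=\bigcup_{U\in\mathcal{U}}(U\times U)$; $\mathcal{U}$ is uniformly bounded if $\Delta_{\mathcal{U}}\in\mathcal{E}$. Coarse property C: for any sequence $L_1\subseteq L_2\subseteq\cdots$ of entourages there are an $n$ and a finite sequence $\mathcal{U}^1,\ldots,\mathcal{U}^n$ of families of subsets of $X$ such that $\bigcup_{i=1}^n\mathcal{U}^i$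 covers $X$, each $\mathcal{U}^i$ is uniformly bounded, and each $\mathcal{U}^i$ is $L_i$-disjoint. Uniform coarse property C for a family $\{X_\alpha\}_\alpha$ of coarse subspaces of $(X,\mathcal{E})$: for any sequence $L_1\subseteq L_2\subseteq\cdots$ in $\mathcal{E}$ there are a sequence $K_1\subseteq K_2\subseteq\cdots$ in $\mathcal{E}$ and an $N\in\mathbb{N}$ such that for each $\alpha$ there is a finite sequence $\mathcal{U}^1_\alpha,\ldots,\mathcal{U}^n_\alpha$, $n\le N$, of families of subsets of $X_\alpha$ such that $\bigcup_{i=1}^n\mathcal{U}^i_\alpha$ covers $X_\alpha$, and for each $i$, $\Delta_{\mathcal{U}^i_\alpha}\subseteq K_i$ and $\mathcal{U}^i_\alpha$ is $L_i$-disjoint. *)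

(* Defs.v *)
From mathcomp Require Import all_boot.
From mathcomp Require Import boolp classical_sets.

Set Implicit Arguments.
Unset Strict Implicit.
Unset Printing Implicit Defensive.

Local Open Scope classical_set_scope.
Local Open Scope relation_scope.

(* In classical_sets, [(x, z)] is in [E2 \; E1] iff [(x, y)] is in [E1] and
   [(y, z)] is in [E2] for some [y].  Closure under binary unions gives all
   nonempty finite unions; [set0] is an entourage as a subset of the diagonal. *)
Record coarse_structure (X : Type) := CoarseStructure {
  entourage : set (set (X * X));
  entourage_sub : forall E F, F `<=` E -> entourage E -> entourage F;
  entourageU : forall E F, entourage E -> entourage F -> entourage (E `|` F);
  entourage_diagonal : entourage diagonal;
  entourageV : forall E, entourage E -> entourage (E^-1);
  entourage_comp : forall E1 E2,
    entourage E1 -> entourage E2 -> entourage (E2 \; E1)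
}.

Section Subspace.
Variables (X : Type) (C : coarse_structure X) (A : set X).

Definition restrict_rel (E : set (X * X)) : set (A * A) :=
  [set xy | E (val xy.1, val xy.2)].

Definition extend_rel (F : set (A * A)) : set (X * X) :=
  [set (val xy.1, val xy.2) | xy in F].

Definition sub_entourage : set (set (A * A)) := restrict_rel @` entourage C.

Lemma extend_relK : cancel extend_rel restrict_rel.
Proof.
move=> F; apply/seteqP; split=> [[x y] /= [[x' y'] Fxy [/val_inj <- /val_inj <-]] //|].
by move=> xy Fxy; exists xy.
Qed.

Lemma sub_entourageP (F : set (A * A)) :
  sub_entourage F <-> entourage C (extend_rel F).
Proof.
split=> [[E CE <-]|CF]; last by exists (extend_rel F); rewrite ?extend_relK.
by apply: entourage_sub CE => _ [[x y] Exy <-].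
Qed.

Lemma sub_entourage_sub E F : F `<=` E -> sub_entourage E -> sub_entourage F.
Proof.
move=> FE /sub_entourageP CE; apply/sub_entourageP.
by apply: entourage_sub CE => _ [xy /FE Exy <-]; exists xy.
Qed.

Lemma sub_entourageU E F :
  sub_entourage E -> sub_entourage F -> sub_entourage (E `|` F).
Proof. by move=> [E' CE <-] [F' CF <-]; exists (E' `|` F'); first exact: entourageU. Qed.

Lemma sub_entourage_diagonal : sub_entourage diagonal.
Proof.
exists diagonal; first exact: entourage_diagonal.
by apply/seteqP; split=> -[x y]; rewrite /restrict_rel /diagonal /=;
  [move/val_inj | move=> ->].
Qed.

Lemma sub_entourageV E : sub_entourage E -> sub_entourage (E^-1).
Proof. by move=> [E' CE <-]; exists (E'^-1); first exact: entourageV. Qed.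

Lemma sub_entourage_comp E1 E2 :
  sub_entourage E1 -> sub_entourage E2 -> sub_entourage (E2 \; E1).
Proof.
move=> [F1 CF1 <-] [F2 CF2 <-].
apply: (@sub_entourage_sub (restrict_rel (F2 \; F1))).
  by move=> [x z] [y F1xy F2yz]; exists (val y).
by exists (F2 \; F1); first exact: entourage_comp.
Qed.

Definition coarse_subspace : coarse_structure A :=
  CoarseStructure sub_entourage_sub sub_entourageU sub_entourage_diagonal
    sub_entourageV sub_entourage_comp.

End Subspace.

Definition rel_disjoint (X : Type) (E : set (X * X)) (U : set (set X)) :=
  forall A B, U A -> U B -> A <> B -> (A `*` B) `&` E = set0.

Definition family_diagonal (X : Type) (U : set (set X)) : set (X * X) :=
  \bigcup_(A in U) (A `*` A).

Definition uniformly_bounded (X : Type) (C : coarse_structure X)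
    (U : set (set X)) :=
  entourage C (family_diagonal U).

Definition increasing_entourages (X : Type) (C : coarse_structure X)
    (L : nat -> set (X * X)) :=
  (forall i, entourage C (L i)) /\ (forall i, L i `<=` L i.+1).

(* Sequences and finite lists of families are indexed from 0, so [L 0] and
   [U ord0] play the role of $L_1$ and $\mathcal{U}^1$. *)
Definition coarse_property_C (X : Type) (C : coarse_structure X) :=
  forall L : nat -> set (X * X), increasing_entourages C L ->
  exists (n : nat) (U : 'I_n -> set (set X)),
    [/\ \bigcup_(i : 'I_n) \bigcup_(A in U i) A = [set: X],
        forall i, uniformly_bounded C (U i)
      & forall i : 'I_n, rel_disjoint (L i) (U i)].

Definition uniform_coarse_property_C (X : Type) (C : coarse_structure X)
    (I : Type) (Xs : I -> set X) :=
  forall L : nat -> set (X * X), increasing_entourages C L ->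
  exists (K : nat -> set (X * X)) (N : nat), increasing_entourages C K /\
    forall a : I, exists (n : nat) (U : 'I_n -> set (set X)),
      [/\ (n <= N)%N,
          forall i A, U i A -> A `<=` Xs a,
          \bigcup_(i : 'I_n) \bigcup_(A in U i) A = Xs a,
          forall i : 'I_n, family_diagonal (U i) `<=` K i
        & forall i : 'I_n, rel_disjoint (L i) (U i)].

(* Main.v *)
Require Import Defs.
From mathcomp Require Import all_boot.
From mathcomp Require Import boolp classical_sets.

(** Given [L], let [N] be the uniform bound on the number of families for the
[Xs a], and choose [Y] for the entourage [L N].  The families of the pieces
[Xs a `\` Y], merged over the pieces, stay disjoint at each stage [i < N]
because distinct pieces are [L N]-disjoint; property C of [Y] applied to the
shifted sequence [L (N + i)] provides the remaining families. *)

Local Open Scope classical_set_scope.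

Lemma increasing_entourages_le (X : Type) (C : coarse_structure X)
    (L : nat -> set (X * X)) : increasing_entourages C L ->
  forall i j, (i <= j)%N -> L i `<=` L j.
Proof.
move=> [_ LS] i j /subnK <-; elim: (j - i)%N => [//|k IHk].
by rewrite addSn; apply: subset_trans IHk (LS _).
Qed.

Lemma rel_disjointP (X : Type) (E : set (X * X)) (U : set (set X)) :
  rel_disjoint E U <->
  forall A B x y, U A -> U B -> A x -> B y -> E (x, y) -> A = B.
Proof.
split=> [dU A B x y UA UB Ax By Exy|dU A B UA UB AB].
  by apply: contrapT => /(dU _ _ UA UB) dAB; have : set0 (x, y) by rewrite -dAB.
apply/seteqP; split=> // -[x y] [[Ax By] Exy].
exact/AB/(dU _ _ _ _ UA UB Ax By Exy).
Qed.

(** Pushing the families forward along [val] keeps them uniformly bounded, because a relation on [Y]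
    is an entourage of the subspace exactly when its extension to [X] is one of [C]. The conclusion
    lives in [X] so that these families can be listed together with those of the pieces. *)
Lemma subspace_coarse_property_C (X : Type) (C : coarse_structure X)
    (Y : set X) (L : nat -> set (X * X)) :
  coarse_property_C (coarse_subspace C Y) -> increasing_entourages C L ->
  exists (n : nat) (U : 'I_n -> set (set X)),
    [/\ Y `<=` \bigcup_(i : 'I_n) \bigcup_(A in U i) A,
        forall i, uniformly_bounded C (U i)
      & forall i : 'I_n, rel_disjoint (L i) (U i)].
Proof.
move=> YC [CL LS].
have [|n [U [Ucov Ubnd Udisj]]] := YC (fun i => restrict_rel (A := Y) (L i)).
  by split=> [i|i xy /LS //]; exists (L i).
pose val_image (A : set Y) : set X := [set val y | y in A].
exists n, (fun i => val_image @` U i); split=> [y Yy|i|i].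
- have : [set: Y] (exist _ y (mem_set Yy)) by [].
  rewrite -Ucov => -[i _ [A UA Ay]].
  by exists i => //; exists (val_image A); [exists A | exists (exist _ y (mem_set Yy))].
- have /sub_entourageP := Ubnd i; apply: entourage_sub.
  move=> [_ _] [_ [A UA <-]] [/= [x Ax <-] [y Ay <-]].
  by exists (x, y) => //; exists A.
- have /rel_disjointP dU := Udisj i.
  apply/rel_disjointP => _ _ _ _ [A UA <-] [B UB <-] [x Ax <-] [y By <-] Lxy.
  by rewrite (dU A B x y).
Qed.

(** Removing [Y] only shrinks members, so bounds and disjointness survive. [K] and [N] are fixed
    before [Y], since [Y] will be chosen for [L N]. *)
Lemma uniform_coarse_property_C_setD (X : Type) (C : coarse_structure X)
    (I : Type) (Xs : I -> set X) (L : nat -> set (X * X)) :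
  uniform_coarse_property_C C Xs -> increasing_entourages C L ->
  exists (K : nat -> set (X * X)) (N : nat), (forall i, entourage C (K i)) /\
    forall (Y : set X) (a : I), exists U : nat -> set (set X),
      [/\ forall i A, U i A -> A `<=` Xs a `\` Y,
          Xs a `\` Y `<=` \bigcup_(i : 'I_N) \bigcup_(A in U i) A,
          forall i, family_diagonal (U i) `<=` K i
        & forall i, rel_disjoint (L i) (U i)].
Proof.
move=> XsC /XsC [K [N [[CK _] famU]]]; exists K, N; split=> // Y a.
have [n [U [nN Usub Ucov Udiag Udisj]]] := famU a.
(* Lists of varying length [n] are padded with empty families from index [n] on, so that all pieces
   share the index type [nat]. *)
exists (fun i => [set B | exists2 j : 'I_n, j = i :> nat &
                          exists2 A, U j A & B = A `\` Y]).
split=> [i _ [j _ [A UA ->]] x [Ax nYx]|x [Xx nYx]|i [x y]|i].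
- by split=> //; apply: (Usub j A UA).
- move: Xx; rewrite -Ucov => -[i _ [A UA Ax]].
  exists (widen_ord nN i) => //; exists (A `\` Y) => //.
  by exists i => //; exists A.
- move=> [_ [j <- [A UA ->]] [/= [Ax _] [Ay _]]].
  by apply: Udiag; exists A.
- apply/rel_disjointP => _ _ x y [j ji [A UA ->]] [k ki [B UB ->]] [Ax _] [By _].
  have /val_inj kj : k = j :> nat by rewrite ki.
  subst k; subst i => Lxy; congr (_ `\` _).
  by have /rel_disjointP dU := Udisj j; apply: dU Lxy.
Qed.

Theorem theorem3p15 (X : Type) (C : coarse_structure X)
    (I : Type) (Xs : I -> set X)
    (Xs_cover : \bigcup_(a : I) Xs a = [set: X])
    (Xs_C : uniform_coarse_property_C C Xs)
    (Xs_disj : forall K : set (X * X), entourage C K ->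
      exists Y : set X,
        coarse_property_C (coarse_subspace C Y) /\
        rel_disjoint K [set Xs a `\` Y | a in [set: I]]) :
  coarse_property_C C.
Proof.
move=> L incL; have [CL LS] := incL.
have [K [N [CK famU]]] := uniform_coarse_property_C_setD _ _ _ _ _ Xs_C incL.
have [Y [YC /rel_disjointP dY]] := Xs_disj _ (CL N).
have [|m [W [Wcov Wbnd Wdisj]]] :=
    subspace_coarse_property_C _ _ _ (fun i => L (N + i)%N) YC.
  by split=> i //; rewrite addnS; apply: LS.
(* Families are chosen per piece [S] rather than per index, because distinct
   indices may give the same piece and then nothing separates their families. *)
pose pieces := [set Xs a `\` Y | a in [set: I]].
have /choice[U UP] : forall S, exists U : nat -> set (set X), pieces S ->
    [/\ forall i A, U i A -> A `<=` S,
        S `<=` \bigcup_(i : 'I_N) \bigcup_(A in U i) A,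
        forall i, family_diagonal (U i) `<=` K i
      & forall i, rel_disjoint (L i) (U i)].
  move=> S; have [[a _ <-]|nS] := pselect (pieces S).
    by have [U UP] := famU Y a; exists U.
  (* A set that is not a piece gets empty families; nothing is required of it. *)
  by exists (fun=> set0) => /nS.
pose V i := \bigcup_(S in pieces) U S i.
exists (N + m)%N, (fun i => match split i with inl j => V j | inr k => W k end).
split=> [|i|i].
- apply/seteqP; split=> // x _; have [Yx|nYx] := pselect (Y x).
    have [k _ [A WA Ax]] := Wcov _ Yx.
    exists (rshift N k) => //; exists A => //=.
    by have -> := unsplitK (inr k : 'I_N + 'I_m).
  have : [set: X] x by [].
  rewrite -Xs_cover => -[a _ Xx].
  have pa : pieces (Xs a `\` Y) by exists a.
  have [_ Ucov _ _] := UP _ pa.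
  have [j _ [A UA Ax]] := Ucov x (conj Xx nYx).
  exists (lshift m j) => //; exists A => //=.
  by have -> := unsplitK (inl j : 'I_N + 'I_m); exists (Xs a `\` Y).
- case: (split i) => [j|k]; last exact: Wbnd.
  (* The same [K j] bounds the [j]-th family of every piece, hence also their union. *)
  apply: entourage_sub (CK j) => xy [A [S pS UA] Axy].
  by have [_ _ Udiag _] := UP _ pS; apply: Udiag; exists A.
(* [W k] stands at position [N + k], which the shift of [L] matches. *)
- case: splitP => [j ->|k ->]; last exact: Wdisj.
  apply/rel_disjointP => A B x y [S pS UA] [T pT UB] Ax By Lxy.
  have [Ssub _ _ /(_ j)/rel_disjointP dS] := UP _ pS.
  have [Tsub _ _ _] := UP _ pT.
  (* As [j < N], the points [x] and [y] are also [L N]-related, so their pieces agree; disjointness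
     inside that one piece then gives [A = B]. *)
  have ST : S = T.
    apply: (dY S T x y) => //; [exact: (Ssub j A UA)|exact: (Tsub j B UB)|].
    exact: (increasing_entourages_le _ _ _ incL _ _ (ltnW (ltn_ord j))).
  by rewrite -ST in UB; apply: dS Lxy.
Qed.
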